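(* Let $n$ be a positive integer, let $R\in\mathbb{R}^{n\times n}$ be a symmetric positive definite matrix, let $a<b$ be integers, and put $\ell=b-a+1$. For any sequence $u:\{a,a+1,\dots,b\}\to\mathbb{R}^n$, written $u_k=u(k)$, define $$\upsilon_1=\sum_{k=a}^b u_k,\qquad \upsilon_2=\sum_{k=a}^b\sum_{s=a}^k u_s,\qquad \upsilon_3=\sum_{k=a}^b\sum_{s=a}^k\sum_{i=a}^s u_i,$$ $$\zeta_1=\upsilon_1-\frac{2}{\ell+1}\upsilon_2,\qquad \zeta_2=\upsilon_1-\frac{6}{\ell+1}\upsilon_2+\frac{12}{(\ell+1)(\ell+2)}\upsilon_3,$$ and $$J_1(u)=\sum_{k=a}^b u_k^TRu_k-\frac1\ell\Big(\sum_{k=a}^b u_k\Big)^TR\Big(\sum_{k=a}^b u_k\Big).$$ Then $$J_1(u)\ \geq\ \frac{3(\ell+1)}{\ell(\ell-1)}\,\zeta_1^TR\zeta_1+\frac{5(\ell+1)(\ell+2)^2}{\ell(\ell-1)(\ell^2+11)}\,\zeta_2^TR\zeta_2 .$$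
   Context: $\ell$ is the number of integers in the interval $[a,b]$. $J_1(u)$ is the gap (left-hand side minus right-hand side) in the discrete Jensen inequality $\sum_{k=a}^b u_k^TRu_k\ge \frac1\ell(\sum_{k=a}^b u_k)^TR(\sum_{k=a}^b u_k)$. *)

(* Defs.v *)
From HB Require Import structures.
From mathcomp Require Import all_boot all_order all_algebra.
From mathcomp Require Import classical_sets fsbigop set_interval reals.

Set Implicit Arguments.
Unset Strict Implicit.
Unset Printing Implicit Defensive.

Import Order.TTheory GRing.Theory Num.Theory.
Local Open Scope ring_scope.

Definition qform (K : realType) (n : nat) (R : 'M[K]_n) (x : 'cV[K]_n) : K :=
  (x^T *m R *m x) 0 0.

Definition sym_posdef (K : realType) (n : nat) (R : 'M[K]_n) : Prop :=
  R \is symmetricmx /\ forall x : 'cV[K]_n, x != 0 -> 0 < qform R x.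

(* Sequences on {a, ..., b} are total functions on [int]; all the definitions
   below only evaluate them on that interval.  The sums range over the finite
   set of the integers k with a <= k <= b. *)
Section Sums.
Variables (K : realType) (n : nat) (a b : int) (u : int -> 'cV[K]_n).

Definition ell : K := (b - a + 1)%:~R.

Definition upsilon1 : 'cV[K]_n := \sum_(k \in `[a, b]%classic) u k.

Definition upsilon2 : 'cV[K]_n :=
  \sum_(k \in `[a, b]%classic) \sum_(s \in `[a, k]%classic) u s.

Definition upsilon3 : 'cV[K]_n :=
  \sum_(k \in `[a, b]%classic) \sum_(s \in `[a, k]%classic)
    \sum_(i \in `[a, s]%classic) u i.

Definition zeta1 : 'cV[K]_n := upsilon1 - (2 / (ell + 1)) *: upsilon2.

Definition zeta2 : 'cV[K]_n :=
  upsilon1 - (6 / (ell + 1)) *: upsilon2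
  + (12 / ((ell + 1) * (ell + 2))) *: upsilon3.

Definition J1 (R : 'M[K]_n) : K :=
  \sum_(k \in `[a, b]%classic) qform R (u k)
  - ell^-1 * qform R (\sum_(k \in `[a, b]%classic) u k).

End Sums.

Arguments ell : clear implicits.

(* Main.v *)
Require Import Defs.
From mathcomp Require Import all_boot all_order all_algebra.
From mathcomp Require Import reals.
From mathcomp Require Import classical_sets fsbigop set_interval.
From mathcomp Require Import ring lra.

(** Why the inequality holds.  Write [v_j = u (a + j)] for [0 <= j < l] and
    [m = l - j].  Exchanging the order of summation turns the iterated sums into
    [upsilon2 = \sum_j m v_j] and [upsilon3 = \sum_j m (m + 1) / 2 v_j], so
    that [upsilon1], [zeta1] and [zeta2] are the sums [\sum_j p m *: v_j] for
    polynomials [p] in [m] of degree 0, 1 and 2.  These three polynomials are,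
    up to scaling, the discrete Legendre polynomials on [{1, ..., l}]: they are
    pairwise orthogonal for the counting measure ([sum_legendre1],
    [sum_legendre2], [sum_legendre21]).  The theorem is therefore a Bessel
    inequality for the form [qform R], with Jensen's term [1 / l] as the
    contribution of the constant polynomial.

    The squared norms are [l], [l (l - 1) / (3 (l + 1))] and
    [l (l - 1) (l - 2) / (5 (l + 1) (l + 2))].  The coefficient of [zeta1] is the
    inverse of the second one.  The coefficient [c2] of [zeta2] is less than
    optimal: the product of [c2] and the third norm is
    [(l ^+ 2 - 4) / (l ^+ 2 + 11) <= 1].  For [l = 2] the quadratic polynomial
    vanishes on [{1, 2}] and has no inverse norm.  Bessel's inequality is
    therefore proved in the form [bessel3], where each coefficient [c] is only
    required to satisfy [c * \sum_i p i ^+ 2 <= 1]; this covers every [l >= 2]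
    at once. *)

Set Implicit Arguments.
Unset Strict Implicit.
Unset Printing Implicit Defensive.

Import Order.TTheory GRing.Theory Num.Theory.
Local Open Scope ring_scope.

(** * From iterated sums over integer intervals to weighted sums *)

Lemma fsbig_itv_int (V : nmodType) (a : int) (n : nat) (f : int -> V) :
  \sum_(k \in `[a, a + n%:Z]%classic) f k = \sum_(j < n.+1) f (a + j%:Z).
Proof.
rewrite (fsbig_ord _ n.+1 (fun j => f (a + j%:Z))).
rewrite (reindex_fsbig (fun j : nat => a + j%:Z) `I_n.+1) //.
split=> [j /= jn|i j _ _ /addrI[]//|k /=].
  by rewrite in_itv /= lerDl lerD2l.
rewrite in_itv /= => /andP[ak kn].
have [j jE] : exists j : nat, k - a = j%:Z.
  by exists `|k - a|%N; rewrite gez0_abs // subr_ge0.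
have kE : k = a + j%:Z by rewrite -jE addrC subrK.
by exists j => //=; move: kn; rewrite kE lerD2l lez_nat ltnS.
Qed.

(** One layer of summation turns the weights [c] into their partial sums [w]:
    the weight depends only on the distance to the end of the range, and passing
    from [N] to [N + 1] raises every distance by one. *)
Lemma iterated_sum_weights (K : pzRingType) (V : lmodType K) (v : nat -> V)
    (c w : nat -> K) (N : nat) :
    w 0 = 0 -> (forall m, w m.+1 = w m + c m.+1) ->
  \sum_(k < N) \sum_(s < k.+1) c (k.+1 - s)%N *: v s
    = \sum_(s < N) w (N - s)%N *: v s.
Proof.
move=> w0 wS; elim: N => [|N IHN]; first by rewrite !big_ord0.
rewrite big_ord_recr /= IHN.
have -> : \sum_(s < N) w (N - s)%N *: v s = \sum_(s < N.+1) w (N - s)%N *: v s.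
  by rewrite [RHS]big_ord_recr /= subnn w0 scale0r addr0.
rewrite -big_split; apply: eq_bigr => s _ /=.
by rewrite -scalerDl subSn ?wS // -ltnS.
Qed.

(** The power sums up to degree 4 in one statement, which suffices for products
    of two polynomials of degree at most 2.  The coefficients may depend on the
    range through [l], hence their appearance as parameters; the values are
    summed in the order [N, ..., 1], the order in which the weights occur. *)
Lemma sum_quartic (K : numFieldType) (N : nat) (l e0 e1 e2 e3 e4 : K)
    (f : nat -> K) :
    l = N%:R ->
    (forall m, f m = e0 + e1 * m%:R + e2 * m%:R ^+ 2 + e3 * m%:R ^+ 3
                     + e4 * m%:R ^+ 4) ->
  \sum_(j < N) f (N - j)%N =
    e0 * l + e1 * (l * (l + 1) / 2) + e2 * (l * (l + 1) * (2 * l + 1) / 6)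
    + e3 * (l * (l + 1) / 2) ^+ 2
    + e4 * (l * (l + 1) * (2 * l + 1) * (3 * l ^+ 2 + 3 * l - 1) / 30).
Proof.
move=> -> fE.
have -> : \sum_(j < N) f (N - j)%N = \sum_(m < N) f m.+1.
  rewrite (reindex_inj rev_ord_inj); apply: eq_bigr => j _ /=.
  by rewrite subKn.
elim: N => [|N IHN]; first by rewrite big_ord0; field.
by rewrite big_ord_recr /= IHN fE -natr1; field.
Qed.

(** * A Bessel inequality with relaxed coefficients *)

Section Bessel.
Variables (K : realType) (n : nat) (R : 'M[K]_n).
Hypothesis hR : sym_posdef R.

Lemma qform_ge0 x : 0 <= qform R x.
Proof.
have [-> | x0] := eqVneq x 0; first by rewrite /qform mulmx0 mxE.
by apply/ltW/(hR.2).
Qed.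

Lemma qform_subZ (x z : 'cV[K]_n) (t : K) :
  qform R (x - t *: z)
    = qform R x - 2 * t * (z^T *m R *m x) 0 0 + t ^+ 2 * qform R z.
Proof.
have RT : R^T = R.
  by move/is_hermitianmxP: hR.1; rewrite expr0 scale1r map_mx_id.
have xz : (x^T *m R *m z) 0 0 = (z^T *m R *m x) 0 0.
  have : (x^T *m R *m z)^T = z^T *m R *m x.
    by rewrite !trmx_mul RT trmxK mulmxA.
  by move/matrixP/(_ 0 0); rewrite mxE.
rewrite /qform.
have -> : (x - t *: z)^T = x^T - t *: z^T by rewrite linearB linearZ.
rewrite !mulmxBl !mulmxBr -!scalemxAl -!scalemxAr.
by move: xz; rewrite !mxE => ->; ring.
Qed.

Variable I : finType.

Definition moment (p : I -> K) (u : I -> 'cV[K]_n) := \sum_i p i *: u i.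

(** For [c] the inverse squared norm of [p], this removes from [u] its component
    along [p]; a smaller [c] removes only a part of it. *)
Definition residual c p u i := u i - (c * p i) *: moment p u.

(** Only multiples of [p] are removed, so an orthogonal weight does not see the
    change.  This is what allows [bessel_step] to be iterated. *)
Lemma moment_residual c p p' u : \sum_i p' i * p i = 0 ->
  moment p' (residual c p u) = moment p' u.
Proof.
move=> pp'; rewrite /moment /residual.
under eq_bigr => i _ do rewrite scalerBr scalerA mulrCA.
by rewrite sumrB -scaler_suml -mulr_sumr pp' mulr0 scale0r subr0.
Qed.

(** With [z = moment p u], expanding the residual gives
    [\sum_i qform R (u i) - (2 c - c ^+ 2 * \sum_i p i ^+ 2) * qform R z], and
    [2 c - c ^+ 2 * \sum_i p i ^+ 2 >= c] by the bound on [c]. *)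
Lemma bessel_step c p u : 0 <= c -> c * (\sum_i p i ^+ 2) <= 1 ->
  c * qform R (moment p u) + \sum_i qform R (residual c p u i)
    <= \sum_i qform R (u i).
Proof.
move=> c0 cp; set z := moment p u.
have cross : \sum_i p i * (z^T *m R *m u i) 0 0 = qform R z.
  rewrite /qform [in RHS]/z /moment mulmx_sumr summxE.
  by apply: eq_bigr => i _; rewrite -scalemxAr [RHS]mxE.
have -> : \sum_i qform R (residual c p u i) = \sum_i qform R (u i)
    - 2 * c * qform R z + c ^+ 2 * (\sum_i p i ^+ 2) * qform R z.
  rewrite -[in X in _ - X]cross !mulr_sumr mulr_suml -sumrB -big_split /=.
  by apply: eq_bigr => i _; rewrite /residual qform_subZ -/z; ring.
have : c * (\sum_i p i ^+ 2) * (c * qform R z) <= 1 * (c * qform R z).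
  by apply: ler_wpM2r => //; rewrite mulr_ge0 ?qform_ge0.
lra.
Qed.

(** Each step acts on the residual of the previous one, in which orthogonality
    has kept the remaining moments of [u]; the last residual has nonnegative
    energy. *)
Lemma bessel3 (c0 c1 c2 : K) (p0 p1 p2 : I -> K) (u : I -> 'cV[K]_n) :
    0 <= c0 -> 0 <= c1 -> 0 <= c2 ->
    c0 * (\sum_i p0 i ^+ 2) <= 1 -> c1 * (\sum_i p1 i ^+ 2) <= 1 ->
    c2 * (\sum_i p2 i ^+ 2) <= 1 ->
    \sum_i p1 i * p0 i = 0 -> \sum_i p2 i * p0 i = 0 ->
    \sum_i p2 i * p1 i = 0 ->
  c0 * qform R (moment p0 u) + c1 * qform R (moment p1 u)
    + c2 * qform R (moment p2 u) <= \sum_i qform R (u i).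
Proof.
move=> c0_ge0 c1_ge0 c2_ge0 n0 n1 n2 p10 p20 p21.
have h0 := bessel_step u c0_ge0 n0.
have := bessel_step (residual c0 p0 u) c1_ge0 n1.
rewrite moment_residual // => h1.
have := bessel_step (residual c1 p1 (residual c0 p0 u)) c2_ge0 n2.
rewrite !moment_residual // => h2.
have : 0 <= \sum_i qform R
    (residual c2 p2 (residual c1 p1 (residual c0 p0 u)) i).
  by apply: sumr_ge0 => i _; apply: qform_ge0.
lra.
Qed.

End Bessel.

(** * Discrete Legendre polynomials of degree 1 and 2 *)

Section Legendre.
Variables (K : realType) (l : K).

(** Legendre polynomials on [{1, ..., l}], normalised to the value 1 at 0.  The
    form of [legendre2] keeps visible the weights [m] and [m (m + 1) / 2] of the
    double and triple sums. *)
Definition legendre1 (m : nat) : K := 1 - 2 / (l + 1) * m%:R.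
Definition legendre2 (m : nat) : K :=
  1 - 6 / (l + 1) * m%:R
  + 12 / ((l + 1) * (l + 2)) * (m%:R * (m%:R + 1) / 2).

Variable N : nat.
Hypothesis lN : l = N%:R.

Let l_ge0 : 0 <= l. Proof. by rewrite lN ler0n. Qed.
Let l1 : l + 1 != 0. Proof. by apply: lt0r_neq0; have := l_ge0; lra. Qed.
Let l2 : l + 2 != 0. Proof. by apply: lt0r_neq0; have := l_ge0; lra. Qed.

Lemma sum_legendre1 : \sum_(j < N) legendre1 (N - j) = 0.
Proof.
rewrite (@sum_quartic _ N l 1 (- (2 / (l + 1))) 0 0 0 legendre1) //.
  by field.
by move=> m; rewrite /legendre1; ring.
Qed.

Lemma sum_legendre2 : \sum_(j < N) legendre2 (N - j) = 0.
Proof.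
rewrite (@sum_quartic _ N l 1 (6 / ((l + 1) * (l + 2)) - 6 / (l + 1))
  (6 / ((l + 1) * (l + 2))) 0 0 legendre2) //.
  by field; rewrite l1 l2.
by move=> m; rewrite /legendre2; field; rewrite l1 l2.
Qed.

(** The coefficients given to [sum_quartic] here and below come from writing
    [legendre1 m = 1 - e m] and [legendre2 m = 1 + f m + d m ^+ 2]. *)
Lemma sum_legendre21 : \sum_(j < N) legendre2 (N - j) * legendre1 (N - j) = 0.
Proof.
pose e := 2 / (l + 1); pose d := 6 / ((l + 1) * (l + 2)).
pose f := d - 6 / (l + 1).
rewrite (@sum_quartic _ N l 1 (f - e) (d - e * f) (- (e * d)) 0
  (fun m => legendre2 m * legendre1 m)) //.
  by rewrite /f /e /d; field; rewrite l1 l2.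
by move=> m; rewrite /legendre2 /legendre1 /f /e /d; field; rewrite l1 l2.
Qed.

Lemma sum_legendre1_sqr :
  \sum_(j < N) legendre1 (N - j) ^+ 2 = l * (l - 1) / (3 * (l + 1)).
Proof.
pose e := 2 / (l + 1).
rewrite (@sum_quartic _ N l 1 (- (2 * e)) (e ^+ 2) 0 0
  (fun m => legendre1 m ^+ 2)) //.
  by rewrite /e; field.
by move=> m; rewrite /legendre1 /e; field.
Qed.

Lemma sum_legendre2_sqr : \sum_(j < N) legendre2 (N - j) ^+ 2
  = l * (l - 1) * (l - 2) / (5 * (l + 1) * (l + 2)).
Proof.
pose d := 6 / ((l + 1) * (l + 2)); pose f := d - 6 / (l + 1).
rewrite (@sum_quartic _ N l 1 (2 * f) (f ^+ 2 + 2 * d) (2 * f * d) (d ^+ 2)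
  (fun m => legendre2 m ^+ 2)) //.
  by rewrite /f /d; field; rewrite l1 l2.
by move=> m; rewrite /legendre2 /f /d; field; rewrite l1 l2.
Qed.

End Legendre.

(** * The vectors of the statement as weighted sums *)

Section Moments.
Variables (K : realType) (n : nat) (a : int) (N : nat) (u : int -> 'cV[K]_n).

Let b : int := a + N%:Z.
Let v (j : nat) := u (a + j%:Z).
Let l : K := ell K a b.

Lemma ell_natr : l = N.+1%:R.
Proof. by rewrite /l /ell /b [a + _]addrC addrK rmorphD -natr1. Qed.

Lemma upsilon1_moment : upsilon1 a b u = \sum_(j < N.+1) v j.
Proof. exact: fsbig_itv_int. Qed.

Lemma upsilon2_moment :
  upsilon2 a b u = \sum_(j < N.+1) (N.+1 - j)%:R *: v j.
Proof.
rewrite /upsilon2 fsbig_itv_int.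
rewrite -(@iterated_sum_weights _ _ v (fun=> 1) (fun m => m%:R)) //; last first.
  by move=> m; rewrite -natr1.
apply: eq_bigr => k _; rewrite fsbig_itv_int.
by apply: eq_bigr => s _; rewrite scale1r.
Qed.

(** Two layers of [iterated_sum_weights]: the weights 1 become integers, then
    triangular numbers. *)
Lemma upsilon3_moment :
  upsilon3 a b u
    = \sum_(j < N.+1) ((N.+1 - j)%:R * ((N.+1 - j)%:R + 1) / 2) *: v j.
Proof.
rewrite /upsilon3 fsbig_itv_int.
rewrite -(@iterated_sum_weights _ _ v (fun m => m%:R)
  (fun m => m%:R * (m%:R + 1) / 2)) //; last 2 first.
- by rewrite !mul0r.
- by move=> m; rewrite -natr1; field.
apply: eq_bigr => k _; rewrite fsbig_itv_int.
rewrite -(@iterated_sum_weights _ _ v (fun=> 1) (fun m => m%:R)) //; last first.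
  by move=> m; rewrite -natr1.
apply: eq_bigr => s _; rewrite fsbig_itv_int.
by apply: eq_bigr => i _; rewrite scale1r.
Qed.

Lemma zeta1_moment : zeta1 a b u
  = moment (fun j : 'I_N.+1 => legendre1 l (N.+1 - j)) (fun j => v j).
Proof.
rewrite /zeta1 -/l upsilon1_moment upsilon2_moment scaler_sumr -sumrB.
by apply: eq_bigr => j _; rewrite /legendre1 scalerBl scale1r scalerA.
Qed.

Lemma zeta2_moment : zeta2 a b u
  = moment (fun j : 'I_N.+1 => legendre2 l (N.+1 - j)) (fun j => v j).
Proof.
rewrite /zeta2 -/l upsilon1_moment upsilon2_moment upsilon3_moment.
rewrite !scaler_sumr -sumrB -big_split.
by apply: eq_bigr => j _; rewrite /legendre2 /= !scalerDl scaleNr scale1r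
  !scalerA.
Qed.

Lemma J1_moment (R : 'M[K]_n) : J1 a b u R = \sum_(j < N.+1) qform R (v j)
  - l^-1 * qform R (moment (fun _ : 'I_N.+1 => 1) (fun j => v j)).
Proof.
rewrite /J1 -/l !fsbig_itv_int; congr (_ - _ * qform R _).
by apply: eq_bigr => j _; rewrite scale1r.
Qed.

End Moments.

(** * The inequality *)

Theorem lemma2 (K : realType) (n : nat) (hn : (0 < n)%N) (R : 'M[K]_n)
    (hR : sym_posdef R) (a b : int) (hab : a < b) (u : int -> 'cV[K]_n) :
  let l : K := ell K a b in
  J1 a b u R >=
    3 * (l + 1) / (l * (l - 1)) * qform R (zeta1 a b u)
    + 5 * (l + 1) * (l + 2) ^+ 2 / (l * (l - 1) * (l ^+ 2 + 11))
      * qform R (zeta2 a b u).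
Proof.
have [N bE] : exists N : nat, b = a + N.+1%:Z.
  exists `|b - a|.-1%N; have ab : 0 < b - a by rewrite subr_gt0.
  by rewrite prednK ?absz_gt0 ?gt_eqF // gtz0_abs // [a + _]addrC subrK.
rewrite {b hab}bE; cbv zeta; set l := ell K a _.
have lE : l = N.+2%:R := ell_natr _ _ _.
have l_ge2 : 2 <= l by rewrite lE ler_nat.
have l0 : l != 0 by apply: lt0r_neq0; lra.
have lm1 : l - 1 != 0 by apply: lt0r_neq0; lra.
have l1 : l + 1 != 0 by apply: lt0r_neq0; lra.
have l2 : l + 2 != 0 by apply: lt0r_neq0; lra.
have l11_gt0 : 0 < l ^+ 2 + 11 by have := sqr_ge0 l; lra.
have l11 := lt0r_neq0 l11_gt0.
rewrite J1_moment zeta1_moment zeta2_moment -/l lerBrDl addrA.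
(* Only [l = N.+2%:R] matters from here on; [field] would unfold [l]. *)
clearbody l.
apply: bessel3 => //.
- by rewrite invr_ge0; lra.
- by apply: divr_ge0; apply: mulr_ge0; lra.
- apply: divr_ge0; first by apply: mulr_ge0; [lra|exact: sqr_ge0].
  by apply: mulr_ge0; [apply: mulr_ge0; lra|exact: ltW].
- under eq_bigr do rewrite expr1n.
  by rewrite sumr_const card_ord -lE mulVf.
- rewrite (sum_legendre1_sqr lE) le_eqVlt; apply/orP; left; apply/eqP.
  by field; rewrite l0 lm1 l1.
- rewrite (sum_legendre2_sqr lE).
  rewrite [leLHS](_ : _ = (l ^+ 2 - 4) / (l ^+ 2 + 11)); last first.
    by field; rewrite l0 lm1 l1 l2 l11.
  by rewrite ler_pdivrMr //; lra.
- by under eq_bigr do rewrite mulr1; apply: sum_legendre1.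
- by under eq_bigr do rewrite mulr1; apply: sum_legendre2.
- exact: sum_legendre21.
Qed.
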